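(* Let $n\ge 6$ and let $G$ be a connected simple graph with $n$ vertices and $n+1$ edges in which two cycles $C_p$ and $C_q$ share exactly one common vertex (i.e. $G\in\mathcal{B}(p,q)$). If $G\not\cong R_n(3,3)$, then $\operatorname{avm}(G)>\operatorname{avm}(R_n(3,3))$.
   Context: $\operatorname{avm}(G)$ is the average of $|M|$ over all maximal matchings $M$ of $G$ (a matching is maximal if not properly contained in another matching). $R_n(3,3)$ is the graph obtained from two triangles $uv_1v_2$ and $uw_1w_2$ sharing exactly the vertex $u$ by attaching $n-5\ge1$ pendant edges (new leaves) to the vertex $v_1$. *)

(* Defs.v *)
From mathcomp Require Import all_boot all_order all_algebra all_fingroup.
Set Implicit Arguments. Unset Strict Implicit. Unset Printing Implicit Defensive.
Import GRing.Theory Num.Theory.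

Section Graphs.
Variable T : finType.

Definition simple_graph (E : {set {set T}}) : Prop :=
  forall e, e \in E -> #|e| = 2.

Definition adj (E : {set {set T}}) : rel T := fun x y => [set x; y] \in E.

Definition connected_graph (E : {set {set T}}) : Prop :=
  forall x y : T, connect (adj E) x y.

Definition is_cycle (E : {set {set T}}) (c : seq T) : Prop :=
  3 <= size c /\ uniq c /\ path.cycle (adj E) c.

Definition two_cycles_one_common_vertex (E : {set {set T}}) : Prop :=
  exists c1 c2 : seq T, is_cycle E c1 /\ is_cycle E c2 /\
    #|[set x | (x \in c1) && (x \in c2)]| = 1.

Definition matching (E M : {set {set T}}) : bool :=
  (M \subset E) &&
  [forall e1 in M, forall e2 in M, (e1 != e2) ==> [disjoint e1 & e2]].

Definition maximal_matching (E M : {set {set T}}) : bool :=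
  matching E M && [forall M', (matching E M' && (M \subset M')) ==> (M' == M)].

Definition maximal_matchings (E : {set {set T}}) : {set {set {set T}}} :=
  [set M | maximal_matching E M].

Definition avm (E : {set {set T}}) : rat :=
  (\sum_(M in maximal_matchings E) (#|M|%:R : rat)) / (#|maximal_matchings E|%:R).

End Graphs.

Definition isomorphic (T : finType) (E1 E2 : {set {set T}}) : Prop :=
  exists f : {perm T}, forall e : {set T}, (e \in E1) = (f @: e \in E2).

(* R_n(3,3) on vertices 0..n-1: u = 0, v1 = 1, v2 = 2, w1 = 3, w2 = 4,
   leaves 5..n-1 attached to v1. *)
Definition R_edge (i j : nat) : bool :=
  ((i, j) \in [:: (0, 1); (0, 2); (1, 2); (0, 3); (0, 4); (3, 4)]) ||
  ((i == 1) && (5 <= j)).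

Definition R33 (n : nat) : {set {set 'I_n}} :=
  [set e : {set 'I_n} | [exists x : 'I_n, exists y : 'I_n,
     [&& e == [set x; y], (nat_of_ord x < nat_of_ord y)%N &
         R_edge (nat_of_ord x) (nat_of_ord y)]]].

(* Main.v *)
Require Import Defs.
From mathcomp Require Import all_boot all_order all_algebra all_fingroup.
From mathcomp Require Import zify.

(**
With k = n - 5, the graph R_n(3,3) has 3k + 4 maximal matchings of total size 7k + 8,
so its average lies between 2 and 7/3. Two cycles meeting in one vertex need three
vertices to be covered, so every maximal matching of G has at least two edges; if all
have at least three, the average is at least 3.

Otherwise a maximal matching {ab, cd} makes {a, b, c, d} a vertex cover (the core).
Counting edges, at most three outer vertices have two or more core neighbours and all
other outer vertices are leaves attached to the core. So G is described by one of
finitely many patterns together with the four numbers of leaves at a, b, c, d. A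
maximal matching is determined by the partners of a, b, c, d, hence the number of
maximal matchings and their total size are polynomials of degree one in each leaf
number. Comparing coefficients proves the inequality for every pattern except those
of R_n(3,3); the patterns are enumerated by computation. The cycle hypothesis enters
only through two vertex sets of minimum degree 2 that meet in one vertex.
*)

Set Implicit Arguments. Unset Strict Implicit. Unset Printing Implicit Defensive.
Import Order.TTheory GRing.Theory Num.Theory.

(** * Matchings and partners *)

Section Matchings.
Variables (T : finType) (E : {set {set T}}).
Hypothesis sE : simple_graph E.

Lemma adjC x y : adj E x y = adj E y x.
Proof. by rewrite /adj setUC. Qed.

Lemma adjxx x : adj E x x = false.
Proof. by apply/negP => /sE; rewrite setUid cards1. Qed.

Lemma edge_neq x y : adj E x y -> x != y.
Proof. by apply: contraL => /eqP ->; rewrite adjxx. Qed.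

Lemma edgeP e : e \in E -> exists x y, adj E x y /\ e = [set x; y].
Proof.
move=> eE; have /eqP/cards2P [x [y [xy eq]]] := sE eE.
by exists x, y; rewrite /adj -eq.
Qed.

Lemma matchingP M : matching E M <->
  M \subset E /\ (forall e1 e2 x, e1 \in M -> e2 \in M -> x \in e1 -> x \in e2 -> e1 = e2).
Proof.
split.
  case/andP => sM dM; split=> // e1 e2 x e1M e2M xe1 xe2.
  apply/eqP/negPn/negP => ne.
  have /(_ e1 e1M)/forall_inP/(_ e2 e2M) := forall_inP dM.
  by rewrite ne /= => /disjointFr/(_ xe1); rewrite xe2.
case=> sM dM; rewrite /matching sM /=.
apply/forall_inP => e1 e1M; apply/forall_inP => e2 e2M; apply/implyP => ne.
apply/pred0P => x /=; apply/negP => /andP [xe1 xe2].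
by move: ne; rewrite (dM e1 e2 x) ?eqxx.
Qed.

(** An edge avoiding all covered vertices could be added to [M]. Conversely, if the covered vertices
    meet every edge, an edge of a larger matching touches an edge of [M], and disjointness makes the
    two equal. *)
Lemma maximal_matchingP M : maximal_matching E M <->
  matching E M /\ (forall x y, adj E x y -> (x \in cover M) || (y \in cover M)).
Proof.
split.
  case/andP => mM /forallP maxM; split=> // x y xy.
  apply/negPn/negP; rewrite negb_or => /andP [xM yM].
  have [sM dM] := (matchingP M).1 mM.
  have nM e z : e \in M -> z \in [set x; y] -> z \in e -> False.
    move=> eM; rewrite !inE => /orP [] /eqP -> ze.
      by move/negP: xM; apply; apply/bigcupP; exists e.
    by move/negP: yM; apply; apply/bigcupP; exists e.
  have /implyP := maxM ([set x; y] |: M).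
  rewrite subsetUr andbT => /(_ _)/eqP eM.
  have /nM nxy : [set x; y] \in M.
    rewrite -eM ?setU11 //; apply/matchingP; split.
      by rewrite subUset sub1set sM andbT.
    move=> e1 e2 z; rewrite !inE => /orP [/eqP ->|e1M] /orP [/eqP ->|e2M] // ze1 ze2.
    - by case: (nM _ _ e2M ze1 ze2).
    - by case: (nM _ _ e1M ze2 ze1).
    - exact: dM ze1 ze2.
  by apply: (nxy x); rewrite !inE eqxx.
case=> mM cM; rewrite /maximal_matching mM /=.
apply/forallP => M'; apply/implyP => /andP [/matchingP [sM' dM'] sMM'].
rewrite eqEsubset sMM' andbT; apply/subsetP => e eM'.
have [x [y [xy ee]]] := edgeP (subsetP sM' _ eM').
have sub z : z \in e -> z \in cover M -> e \in M.
  move=> ze /bigcupP [e1 e1M ze1].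
  by rewrite (dM' e e1 z) // (subsetP sMM').
case/orP: (cM _ _ xy); apply: sub; by rewrite ee !inE eqxx ?orbT.
Qed.

(** The default value [x] encodes an unmatched vertex; a simple graph has no loops, so this is
    unambiguous. *)
Definition partner (M : {set {set T}}) (x : T) : T :=
  odflt x [pick y | [set x; y] \in M].

Lemma partner_adj M x : partner M x = x \/ [set x; partner M x] \in M.
Proof. by rewrite /partner; case: pickP => [y yM|_]; [right|left]. Qed.

Lemma partnerE M x y : matching E M -> [set x; y] \in M -> partner M x = y.
Proof.
move=> /matchingP [sM dM] xyM; rewrite /partner.
case: pickP => [z zM /=|/(_ y)]; last by rewrite xyM.
have e : [set x; z] = [set x; y] by apply: (dM _ _ x); rewrite ?inE ?eqxx.
have : z \in [set x; y] by rewrite -e !inE eqxx orbT.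
rewrite !inE => /orP [] /eqP // zx.
by move: (subsetP sM _ zM); rewrite zx; have := adjxx x; rewrite /adj => ->.
Qed.

End Matchings.

(** * Vertex covers of two cycles meeting in one vertex *)

Section TwoCycles.
Variables (T : finType) (E : {set {set T}}).
Hypothesis sE : simple_graph E.

Definition closed2 (c : seq T) := forall x, x \in c ->
  exists y z, [/\ y \in c, z \in c, y != z, adj E x y & adj E x z].

(** Rotate [x] to the front: its neighbours are then the second and the last entry, distinct because
    the cycle has at least three distinct vertices. *)
Lemma cycle_closed2 c : is_cycle E c -> closed2 c.
Proof.
move=> [sc [uc cc]] x xc; have [i s es] := rot_to xc.
have mc y : (y \in c) = (y \in x :: s) by rewrite -es mem_rot.
move: sc uc cc; rewrite -(size_rot i) -(rot_uniq i) -(rot_cycle i) es.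
case: s es mc => [|y [|z s]] // es mc _ /= /and4P [_ ynz _ _] /and3P [xy _].
rewrite rcons_path => /andP [_ lx].
exists y, (last z s); split=> //.
- by rewrite mc !inE eqxx orbT.
- by rewrite mc !in_cons -in_cons mem_last !orbT.
- by apply: contraNneq ynz => ->; apply: mem_last.
- by rewrite adjC.
Qed.

Variables c1 c2 : seq T.
Hypothesis closed_c1 : closed2 c1.
Hypothesis closed_c2 : closed2 c2.
Variable u : T.
Hypothesis c12 : forall x, (x \in c1) && (x \in c2) = (x == u).

(** If some vertex of [c] is outside [X], its two neighbours in [c] must lie in [X]; otherwise [u]
    and a neighbour of it serve. *)
Lemma closed2_cover (X : {set T}) c : closed2 c -> u \in c ->
  (forall x y, adj E x y -> (x \in X) || (y \in X)) ->
  exists p q, [/\ p \in c, q \in c, p != q, p \in X & q \in X].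
Proof.
move=> cc uc cX.
have out x : x \in c -> x \notin X ->
  exists p q, [/\ p \in c, q \in c, p != q, p \in X & q \in X].
  move=> xc xX; have [y [z [yc zc yz xy xz]]] := cc x xc; exists y, z; split=> //.
    by have := cX _ _ xy; rewrite (negbTE xX).
  by have := cX _ _ xz; rewrite (negbTE xX).
have [uX|/(out u uc) //] := boolP (u \in X).
have [y [_ [yc _ _ uy _]]] := cc u uc.
have [yX|/(out y yc) //] := boolP (y \in X).
by exists u, y; split=> //; apply: (edge_neq sE uy).
Qed.

(** Both closed sets contain two vertices of [X]. If [X] had only two elements, these would be
    common to [c1] and [c2], which share only [u]. *)
Lemma cover_gt2 (X : {set T}) :
  (forall x y, adj E x y -> (x \in X) || (y \in X)) -> 2 < #|X|.
Proof.
move=> cX; rewrite ltnNge; apply/negP => X2.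
have /andP [u1 u2] : (u \in c1) && (u \in c2) by rewrite c12.
have [p [q [p1 q1 pq pX qX]]] := closed2_cover closed_c1 u1 cX.
have [p' [q' [p2 q2 pq' pX' qX']]] := closed2_cover closed_c2 u2 cX.
have eX a b : a != b -> a \in X -> b \in X -> [set a; b] = X.
  move=> ab aX bX; apply/eqP; rewrite eqEcard cards2 ab X2 andbT.
  by apply/subsetP => z; rewrite !inE => /orP [] /eqP ->.
have X2c z : z \in X -> z \in c2.
  by rewrite -(eX p' q') // !inE => /orP [] /eqP ->.
have pu : p = u by apply/eqP; rewrite -c12 p1 X2c.
have qu : q = u by apply/eqP; rewrite -c12 q1 X2c.
by rewrite pu qu eqxx in pq.
Qed.

Lemma maximal_matching_ge2 M : maximal_matching E M -> 2 <= #|M|.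
Proof.
move=> maxM; have [mM cM] := (maximal_matchingP sE M).1 maxM.
have [sM _] := (matchingP E M).1 mM.
have := leq_trans (cover_gt2 cM) (leq_card_cover M).
rewrite (eq_bigr (fun _ => 2)); last by move=> e /(subsetP sM)/sE.
by rewrite sum_nat_const; lia.
Qed.

End TwoCycles.

(** * Multi-affine polynomials *)

(* Polynomials of degree at most one in each of [d] variables: [(p, q)] stands for
   [p + x q], with [x] the first variable. *)
Fixpoint maff (d : nat) : Type := if d is d'.+1 then (maff d' * maff d')%type else nat.

Fixpoint peval d : maff d -> seq nat -> nat :=
  if d is d'.+1 return maff d -> seq nat -> nat
  then fun p l => peval p.1 (behead l) + head 0 l * peval p.2 (behead l)
  else fun p _ => p.

Fixpoint pconst d (c : nat) : maff d :=
  if d is d'.+1 return maff d then (pconst d' c, pconst d' 0) else c.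

Fixpoint padd d : maff d -> maff d -> maff d :=
  if d is d'.+1 return maff d -> maff d -> maff d
  then fun p q => (padd p.1 q.1, padd p.2 q.2)
  else fun p q => p + q.

Fixpoint pscale (m d : nat) : maff d -> maff d :=
  if d is d'.+1 return maff d -> maff d
  then fun p => (pscale m p.1, pscale m p.2)
  else fun p => m * p.

Fixpoint plin d (c : nat) : maff d :=
  if d is d'.+1 return maff d then (plin d' c, pconst d' 1) else c.

(* Coefficientwise comparison after substituting [x + 1] for the variables marked
   positive in [pres], and [0] for the others. *)
Fixpoint ple d : seq bool -> maff d -> maff d -> bool :=
  if d is d'.+1 return seq bool -> maff d -> maff d -> bool
  then fun pres p q =>
    if head false pres then
      ple (behead pres) (padd p.1 p.2) (padd q.1 q.2) && ple (behead pres) p.2 q.2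
    else ple (behead pres) p.1 q.1
  else fun _ p q => p <= q.

Lemma peval_const d c l : peval (pconst d c) l = c.
Proof. by elim: d c l => //= d IH c l; rewrite !IH muln0 addn0. Qed.

Lemma peval_add d (p q : maff d) l : peval (padd p q) l = peval p l + peval q l.
Proof. by elim: d p q l => //= d IH p q l; rewrite !IH; lia. Qed.

Lemma peval_scale m d (p : maff d) l : peval (pscale m p) l = m * peval p l.
Proof. by elim: d p l => //= d IH p l; rewrite !IH; lia. Qed.

Lemma peval_lin d c l : size l = d -> peval (plin d c) l = c + sumn l.
Proof.
elim: d c l => [|d IH] c [|a l] //=; first by rewrite addn0.
by case=> sl; rewrite IH // peval_const; lia.
Qed.

Lemma ple_eval d (p q : maff d) l : size l = d ->
  ple [seq 0 < a | a <- l] p q -> peval p l <= peval q l.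
Proof.
elim: d p q l => [|d IH] p q [|[|a] l] //= [sl].
  by move/(IH _ _ _ sl); rewrite !mul0n !addn0.
case/andP => /(IH _ _ _ sl); rewrite !peval_add => h1 /(IH _ _ _ sl) h2.
nia.
Qed.

(** * Patterns *)

(* The vertices of a core and the other vertices with at least two core neighbours
   are numbered from 0, core first, and are at most 7; row [c] lists the adjacencies
   of vertex [c] to the core. Code [7 + i] stands for any leaf attached to core
   vertex [i], and [pres] tells which core vertices carry leaves. *)
Section Check.
Variable rows : seq (seq bool).

Definition core_adj (i c : nat) : bool :=
  if c < 7 then nth false (nth [::] rows c) i else c == 7 + i.

(** The last case is [false] because the core is a vertex cover: outer vertices are pairwise
    nonadjacent. *)
Definition class_adj (c c' : nat) : bool :=
  if c < 4 then core_adj c c' else if c' < 4 then core_adj c' c else false.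

Definition opt (i c : nat) : bool := (c == i) || core_adj i c.

Definition class_sat (s : seq nat) (y : nat) : bool :=
  has (fun j => (nth 0 s j != j) && ((y == j) || (y == nth 0 s j))) (iota 0 4).

(* [nth 0 s i] is the code of the partner of core vertex [i], or [i] itself when [i]
   is unmatched. *)
Definition config (pres : seq bool) (s : seq nat) : bool :=
  all (fun i => [&& opt i (nth 0 s i),
      all (fun j => (j != i) ==> (nth 0 s j != nth 0 s i)) (iota 0 4),
      all (fun j => (nth 0 s i == j) ==> (nth 0 s j == i)) (iota 0 4) &
      (nth 0 s i == i) ==> ~~ nth false pres i &&
        all (fun y => core_adj i y ==> class_sat s y) (iota 0 (size rows))])
    (iota 0 4).

(** Each edge is counted at its end of smaller code, always a core vertex; an unmatched vertex has
    its own code and is not counted. *)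
Definition config_size (s : seq nat) : nat := count (fun i => i < nth 0 s i) (iota 0 4).

Definition config_weight pres (phi : nat -> nat) (s : seq nat) : nat :=
  if config pres s then phi (config_size s) else 0.

(* A necessary condition for [rcons s c] to extend to a configuration; it only
   prunes the enumeration. *)
Definition fits (s : seq nat) (c : nat) : bool :=
  if opt (size s) c then
    if size s \in s then c == index (size s) s else (size s <= c) && (c \notin s)
  else false.

(** The next core vertex takes either a numbered partner or one of its own leaves. The leaves are
    interchangeable, so their number enters as a variable of degree one. *)
Fixpoint count_poly (pres : seq bool) (f : seq nat -> nat) (d : nat) (s : seq nat) : maff d :=
  if d is d'.+1 return maff d then
    (foldr (fun c p => padd (count_poly pres f d' (rcons s c)) p) (pconst d' 0)
       [seq c <- iota 0 (size rows) | fits s c],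
     if nth false pres (size s) then
       if fits s (7 + size s) then count_poly pres f d' (rcons s (7 + size s)) else pconst d' 0
     else pconst d' 0)
  else f s.

Definition matching_poly pres phi : maff 4 := count_poly pres (config_weight pres phi) 4 [::].

(* With [k := n - 5], [N] the number of maximal matchings and [Z] their total size,
   the goal [(7k + 8) N < (3k + 4) Z] reads [0 < k (3 Z - 7 N) + 4 (Z - 2 N)]. It
   follows from [7 N <= 3 Z] and [2 N < Z]; the second alternative is needed only
   when all leaves hang on the common vertex of two triangles. *)
Definition criterion (pres : seq bool) : bool :=
  let N := matching_poly pres (fun _ => 1) in
  let Z := matching_poly pres id in
  let N2 := pscale 2 N in
  let N7 := pscale 7 N in
  let Z3 := pscale 3 Z in
  (ple pres N7 Z3 && ple pres (padd N2 (pconst 4 1)) Z) ||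
  (ple pres N7 (padd Z3 (pconst 4 3)) &&
   ple pres (padd N2 (plin 4 (size rows))) (padd Z (pconst 4 5))).

Definition edge_count : nat :=
  sumn [seq count (fun i => (i < c) && core_adj i c) (iota 0 4) | c <- iota 0 (size rows)].

Definition min_degree2 (A : seq bool) : bool :=
  all (fun c => nth false A c ==>
    (2 <= count (fun c' => nth false A c' && class_adj c c') (iota 0 (size rows))))
    (iota 0 (size rows)).

Definition meet1 (A B : seq bool) : bool :=
  count (fun c => nth false A c && nth false B c) (iota 0 (size rows)) == 1.

(** Absence of further edges is not tested: it follows from the edge count in [R33_iso]. *)
Definition R33_at (pres : seq bool) (u v1 v2 w1 w2 : nat) : bool :=
  [&& uniq [:: u; v1; v2; w1; w2],
      [&& class_adj u v1, class_adj u v2, class_adj v1 v2,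
          class_adj u w1, class_adj u w2 & class_adj w1 w2],
      all (fun c => (c \notin [:: u; v1; v2; w1; w2]) ==> class_adj v1 c)
          (iota 0 (size rows)) &
      all (fun i => nth false pres i ==> (i == v1)) (iota 0 4)].

(** Conditionals replace [&&] so that call-by-value evaluation skips the inner searches once an
    adjacency fails. *)
Definition R33_pattern (pres : seq bool) : bool :=
  let I := iota 0 (size rows) in
  has (fun u => has (fun v1 => if class_adj u v1 then
    has (fun v2 => if class_adj v1 v2 then
    has (fun w1 => if class_adj u w1 then
    has (fun w2 => R33_at pres u v1 v2 w1 w2)
    I else false) I else false) I else false) I) I.

End Check.

Fixpoint words (X : Type) (L : seq X) (r : nat) : seq (seq X) :=
  if r is r'.+1 then flatten [seq [seq x :: s | s <- words L r'] | x <- L] else [:: [::]].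

Lemma mem_words (X : eqType) (L s : seq X) : {subset s <= L} -> s \in words L (size s).
Proof.
elim: s => //= x s IH sL; apply/flatten_mapP; exists x; first by rewrite sL ?mem_head.
by rewrite map_f // IH // => y ys; rewrite sL // inE ys orbT.
Qed.

Definition bools := [:: true; false].

(** Core edges 01 and 23 are those of the maximal matching of size two; the four bits are the other
    possible core edges. *)
Definition core_rows (b02 b03 b12 b13 : bool) : seq (seq bool) :=
  [:: [:: false; true; b02; b03]; [:: true; false; b12; b13];
      [:: b02; b12; false; true]; [:: b03; b13; true; false]].

Definition two_cycle_pattern rows : bool :=
  let G := filter (min_degree2 rows) (words bools (size rows)) in
  has (fun A => has (meet1 rows A) G) G.

(** A leaf adds one vertex and one edge, so the numbered part alone must have one edge more than
    vertices. The test on [pres] drops leafless patterns on fewer than six vertices. *)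
Definition check_rows rows : bool :=
  if edge_count rows == (size rows).+1 then
    if two_cycle_pattern rows then
      all (fun pres => if (6 <= size rows) || has id pres then
           if criterion rows pres then true else R33_pattern rows pres else true)
        (words bools 4)
    else true
  else true.

Definition check_all : bool :=
  all (fun bs => all (fun r => all (fun ms =>
      check_rows (core_rows (nth false bs 0) (nth false bs 1)
                            (nth false bs 2) (nth false bs 3) ++ ms))
    (words [seq m <- words bools 4 | 2 <= count id m] r)) (iota 0 4)) (words bools 4).

(** There are 16 choices of further core edges, 11 possible rows for each of at most three outer
    vertices, and 16 sets of core vertices carrying leaves. *)
Lemma check_allT : check_all = true.
Proof. by vm_compute. Qed.

(** * Counting maximal matchings over a four-vertex cover *)

(* The first four entries of [vs] form a vertex cover, and every vertex outside [vs]
   is a leaf attached to entry [nb x]. *)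
Section Layout.
Variables (T : finType) (E : {set {set T}}).
Hypothesis sE : simple_graph E.
Variables (x0 : T) (vs : seq T) (nb : T -> nat).
Notation k := (nth x0 vs).
Hypothesis vs_uniq : uniq vs.
Hypothesis vs_ge4 : 4 <= size vs.
Hypothesis vs_le7 : size vs <= 7.
Hypothesis nb_lt4 : forall x, x \notin vs -> nb x < 4.
Hypothesis adj_nb : forall x i, x \notin vs -> i < 4 -> adj E (k i) x = (i == nb x).
Hypothesis vs_cover : forall x y, adj E x y -> (index x vs < 4) || (index y vs < 4).

Definition layout_rows := [seq [seq adj E (k i) x | i <- iota 0 4] | x <- vs].
Definition leaves (i : nat) := #|[set x | (x \notin vs) && (nb x == i)]|.
Definition layout_leaves := [seq leaves i | i <- iota 0 4].
Definition layout_pres := [seq 0 < a | a <- layout_leaves].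
Definition cls x := if x \in vs then index x vs else 7 + nb x.

Notation rows := layout_rows.
Notation pres := layout_pres.

Lemma size_rows : size rows = size vs.
Proof. by rewrite size_map. Qed.

Lemma cls_k i : i < size vs -> cls (k i) = i.
Proof. by move=> lt_i; rewrite /cls mem_nth // index_uniq. Qed.

Lemma cls_lt7 x : (cls x < 7) = (x \in vs).
Proof.
rewrite /cls; case: ifP => xvs; last by lia.
by rewrite (leq_trans _ vs_le7) // index_mem.
Qed.

Lemma k_cls x : cls x < 7 -> k (cls x) = x.
Proof. by rewrite cls_lt7 /cls => xvs; rewrite xvs nth_index. Qed.

Lemma cls_inj x y : cls x < 7 -> cls x = cls y -> x = y.
Proof. by move=> lx e; rewrite -(k_cls lx) e k_cls // -e. Qed.

Lemma cls_lt_size x : x \in vs -> cls x < size vs.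
Proof. by rewrite /cls => xvs; rewrite xvs index_mem. Qed.

Lemma cls_lt4 x : (cls x < 4) = (index x vs < 4).
Proof.
rewrite /cls; case: ifP => // xvs; rewrite [RHS]ltnNge memNindex ?xvs //.
by rewrite vs_ge4; lia.
Qed.

Lemma core_adj_cls i x : i < 4 -> core_adj rows i (cls x) = adj E (k i) x.
Proof.
move=> li; rewrite /core_adj cls_lt7; case: ifP => xvs.
  rewrite (nth_map x0) ?cls_lt_size // k_cls ?cls_lt7 //.
  by rewrite (nth_map 0) ?size_iota // nth_iota.
by rewrite /cls xvs adj_nb ?xvs //; lia.
Qed.

Lemma class_adj_cls x y : x \in vs -> y \in vs ->
  class_adj rows (cls x) (cls y) = adj E x y.
Proof.
move=> xvs yvs; rewrite /class_adj.
case: ifP => lx; first by rewrite core_adj_cls // k_cls ?cls_lt7.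
case: ifP => ly; first by rewrite core_adj_cls // k_cls ?cls_lt7 // adjC.
apply/esym/negP => /vs_cover; rewrite -!cls_lt4 lx ly //.
Qed.

Lemma nth_leaves i : i < 4 -> nth 0 layout_leaves i = leaves i.
Proof. by move=> li; rewrite (nth_map 0) ?size_iota // nth_iota. Qed.

Lemma nth_pres i : i < 4 -> nth false pres i = (0 < leaves i).
Proof. by move=> li; rewrite (nth_map 0) ?size_map // nth_leaves. Qed.

Lemma sum_cls (G : nat -> nat) :
  \sum_(x : T) G (cls x) =
  \sum_(c <- iota 0 (size vs)) G c + \sum_(i < 4) leaves i * G (7 + i).
Proof.
rewrite (bigID (mem vs)) /=; congr (_ + _).
  rewrite -big_uniq //= big_seq.
  rewrite (eq_bigr (fun x => G (index x vs))); last by move=> x xvs; rewrite /cls xvs.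
  rewrite -big_seq (big_nth x0) -/(index_iota 0 (size vs)).
  rewrite /index_iota subn0 big_seq [RHS]big_seq; apply: eq_bigr => c.
  by rewrite mem_iota => /andP [_ lc]; rewrite index_uniq.
rewrite (partition_big (fun x => inord (nb x) : 'I_4) predT) //=.
apply: eq_bigr => i _.
rewrite /leaves -sum1_card big_distrl /=.
apply: eq_big => [x|x /andP [xvs /eqP <-]].
  rewrite inE; case xvs: (x \in vs) => //=.
  by rewrite -val_eqE /= inordK // nb_lt4 ?xvs.
by rewrite mul1n inordK ?nb_lt4 // /cls (negbTE xvs).
Qed.

Lemma card_layout : #|T| = size vs + sumn layout_leaves.
Proof.
rewrite -sum1_card (sum_cls (fun _ => 1)) sum1_size size_iota; congr (_ + _).
rewrite sumnE big_map -[iota 0 4]/(index_iota 0 4) big_mkord.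
by apply: eq_bigr => i _; rewrite muln1.
Qed.

Lemma peval_psum (d : nat) (F : nat -> maff d) (s : seq nat) l :
  peval (foldr (fun c p => padd (F c) p) (pconst d 0) s) l = \sum_(c <- s) peval (F c) l.
Proof.
elim: s => [|c s IH] /=; first by rewrite big_nil peval_const.
by rewrite big_cons peval_add IH.
Qed.

(** This sum ranges over tuples of actual vertices; [count_poly] is its symbolic form. *)
Fixpoint class_sum (f : seq nat -> nat) (d : nat) (s : seq nat) : nat :=
  if d is d'.+1 then \sum_(x : T) class_sum f d' (rcons s (cls x)) else f s.

Lemma class_sum_eq0 f d s : (forall t, size t = d -> f (s ++ t) = 0) -> class_sum f d s = 0.
Proof.
elim: d s => [|d IH] s f0 /=; first by rewrite -[s]cats0 f0.
by apply: big1 => x _; apply: IH => t st; rewrite -cats1 -catA f0 //= st.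
Qed.

(** The second hypothesis says that pruning by [fits] discards only zero terms. Numbered vertices
    yield the constant part and leaves the coefficient of the variable. *)
Lemma class_sum_peval f d s : size s + d = 4 ->
  (forall t c t', size t + size t' = 3 -> ~~ fits rows t c -> f (t ++ c :: t') = 0) ->
  class_sum f d s = peval (count_poly rows pres f d s) (drop (size s) layout_leaves).
Proof.
move=> + f0; elim: d s => [|d IH] s sd //=.
have ls : size s < 4 by lia.
have fit0 c : ~~ fits rows s c -> class_sum f d (rcons s c) = 0.
  by move=> nf; apply: class_sum_eq0 => t st; rewrite cat_rcons f0 //; lia.
have hd : head 0 (drop (size s) layout_leaves) = leaves (size s).
  by rewrite -nth0 nth_drop addn0 nth_leaves.
have bd c : behead (drop (size s) layout_leaves) = drop (size (rcons s c)) layout_leaves.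
  by rewrite size_rcons -drop1 drop_drop add1n.
rewrite (sum_cls (fun c => class_sum f d (rcons s c))) hd; congr (_ + _).
  rewrite peval_psum big_filter size_rows [RHS]big_mkcond /=.
  apply: eq_bigr => c _; case: ifP => fc; last by rewrite fit0 ?fc.
  by rewrite (bd c) IH // size_rcons; lia.
(* Among leaf codes only that of core vertex [size s] survives, since a leaf of another core vertex
   is not adjacent to it. *)
rewrite (bigD1 (Ordinal ls)) //= big1 ?addn0.
  case: (posnP (leaves (size s))) => [->|l0]; first by rewrite !mul0n.
  rewrite nth_pres // l0; case: ifP => fc; last by rewrite fit0 ?fc // peval_const.
  by rewrite (bd (7 + size s)) IH // size_rcons; lia.
move=> i; rewrite -val_eqE /= => ni; rewrite fit0 ?muln0 //.
rewrite /fits; have -> // : opt rows (size s) (7 + i) = false.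
by rewrite /opt /core_adj ltnNge leq_addr /=; lia.
Qed.

(** * Maximal matchings and configurations of partners *)

Definition quad (p : T * T * T * T) : seq T := [:: p.1.1.1; p.1.1.2; p.1.2; p.2].

Definition quad_matching p : {set {set T}} :=
  [set [set k i; nth x0 (quad p) i] | i : 'I_4 in [set i : 'I_4 | i < cls (nth x0 (quad p) i)]].

Definition partners (M : {set {set T}}) : T * T * T * T :=
  (partner M (k 0), partner M (k 1), partner M (k 2), partner M (k 3)).

Lemma nth_partners M i : i < 4 -> nth x0 (quad (partners M)) i = partner M (k i).
Proof. by case: i => [|[|[|[|]]]]. Qed.

Lemma partners_eqP M p :
  (forall i, i < 4 -> partner M (k i) = nth x0 (quad p) i) <-> partners M = p.
Proof.
split=> [h|<- i li]; last by rewrite nth_partners.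
case: p h => [[[p0 p1] p2] p3] h.
by rewrite /partners (h 0) // (h 1) // (h 2) // (h 3).
Qed.

Lemma configP s : config rows pres s <-> forall i, i < 4 ->
  [/\ opt rows i (nth 0 s i),
      forall j, j < 4 -> j != i -> nth 0 s j != nth 0 s i,
      forall j, j < 4 -> nth 0 s i = j -> nth 0 s j = i &
      nth 0 s i = i -> leaves i = 0 /\
        forall y, y < size vs -> core_adj rows i y -> class_sat s y].
Proof.
split.
  move=> /allP cs i li; have /and4P [] := cs i (eq_ind_r is_true li (mem_iota 0 4 i)).
  move=> oi /allP di /allP si ui; split=> //.
  - by move=> j lj; move: (di j); rewrite mem_iota => /(_ lj)/implyP.
  - by move=> j lj /eqP e; move: (si j); rewrite mem_iota e => /(_ lj)/eqP.
  move=> /eqP e; move: ui; rewrite e /= nth_pres // lt0n negbK => /andP [/eqP -> /allP ay].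
  split=> // y ly; apply/implyP; apply: ay.
  by rewrite mem_iota size_rows.
move=> h; apply/allP => i; rewrite mem_iota => li.
have [oi di si ui] := h i li; apply/and4P; split=> //.
- by apply/allP => j; rewrite mem_iota => lj; apply/implyP; apply: di.
- by apply/allP => j; rewrite mem_iota => lj; apply/implyP => /eqP e; rewrite (si j).
apply/implyP => /eqP /ui [l0 ay]; rewrite nth_pres // l0 /=.
by apply/allP => y; rewrite mem_iota size_rows => ly; apply/implyP; apply: ay.
Qed.

Lemma k_inj i j : i < size vs -> j < size vs -> k i = k j -> i = j.
Proof. by move=> li lj /(f_equal cls); rewrite !cls_k. Qed.

Lemma lt_vs i : i < 4 -> i < size vs.
Proof. by move=> li; apply: leq_trans li vs_ge4. Qed.

Lemma cls_eqk x i : i < 4 -> cls x = i -> x = k i.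
Proof. by move=> li e; apply: cls_inj; rewrite ?cls_k ?e ?lt_vs //; lia. Qed.

Lemma in_cover_partner M x : matching E M -> x \in cover M -> [set x; partner M x] \in M.
Proof.
move=> mM /bigcupP [e eM xe]; have [sM _] := (matchingP E M).1 mM.
have [y [z [yz ee]]] := edgeP sE (subsetP sM _ eM).
move: xe eM; rewrite ee !inE => /orP [] /eqP -> eM; first by rewrite (partnerE sE mM eM).
by rewrite setUC in eM; rewrite (partnerE sE mM eM).
Qed.

(** Admissible partners come from [M] being a set of edges, injectivity and symmetry from
    disjointness, and the conditions on unmatched core vertices from maximality. *)
Lemma maximal_config p : maximal_matching E (quad_matching p) ->
  partners (quad_matching p) = p -> config rows pres (map cls (quad p)).
Proof.
set M := quad_matching p => maxM /partners_eqP pM.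
have [mM cM] := (maximal_matchingP sE M).1 maxM.
have [sM dM] := (matchingP E M).1 mM.
set m := nth x0 (quad p) in pM *.
have cE i : i < 4 -> nth 0 (map cls (quad p)) i = cls (m i).
  by move=> li; rewrite (nth_map x0).
have M_mem i : i < 4 -> m i != k i -> [set k i; m i] \in M.
  by move=> li ne; case: (partner_adj M (k i)); rewrite pM // => h; rewrite h eqxx in ne.
have M_adj i : i < 4 -> m i != k i -> adj E (k i) (m i).
  by move=> li ne; apply: (subsetP sM); apply: M_mem.
have M_sym x y : [set x; y] \in M -> partner M x = y /\ partner M y = x.
  by move=> h; split; apply: (partnerE sE mM) => //; rewrite setUC.
have m_leaf i : i < 4 -> m i \notin vs -> cls (m i) = 7 + i.
  move=> li nvs; have ne : m i != k i.
    by apply: contraNneq nvs => ->; apply/mem_nth/lt_vs.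
  by move: (M_adj i li ne); rewrite adj_nb // /cls (negbTE nvs) => /eqP <-.
have clsm i : i < 4 -> cls (m i) = i -> m i = k i by move=> li; apply: cls_eqk.
(* Every edge has a core end, so covered vertices can be found from the core entries alone. *)
have coverk x : x \in cover M -> exists2 j, j < 4 & m j != k j /\ (x = k j \/ x = m j).
  move=> xc; have xM := in_cover_partner mM xc.
  have [e1 e2] := M_sym _ _ xM.
  have xy : adj E x (partner M x) by apply: (subsetP sM).
  have := edge_neq sE xy; have := vs_cover xy.
  rewrite -!cls_lt4 => /orP [] lj ne.
    have kx : k (cls x) = x by apply: k_cls; lia.
    exists (cls x) => //; rewrite -pM // kx; split; last by left.
    by rewrite eq_sym.
  have kx : k (cls (partner M x)) = partner M x by apply: k_cls; lia.
  by exists (cls (partner M x)) => //; rewrite -pM // kx e2; split=> //; right.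
apply/configP => i li; split.
- rewrite cE // /opt; have [->|ne] := eqVneq (m i) (k i); first by rewrite cls_k ?lt_vs ?eqxx.
  by rewrite core_adj_cls // M_adj ?orbT.
- move=> j lj nji; rewrite !cE //; apply/eqP => e.
  (* Equal leaf codes name the same core vertex, while equal codes below 7 name the same partner. *)
  have [mvs|mvs] := boolP (m i \in vs); last first.
    have mvsj : m j \notin vs by rewrite -cls_lt7 e cls_lt7.
    by move: e; rewrite !m_leaf //; lia.
  have em : m i = m j by apply: cls_inj; [rewrite cls_lt7 | rewrite e].
  have kij : k i <> k j by move/k_inj; rewrite !lt_vs // => /(_ isT isT); lia.
  have [ei|ni] := eqVneq (m i) (k i); have [ej|nj] := eqVneq (m j) (k j).
  + by apply: kij; rewrite -ei em.
  + have [_] := M_sym _ _ (M_mem j lj nj).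
    by rewrite -em ei pM // ei.
  + have [_] := M_sym _ _ (M_mem i li ni).
    by rewrite em ej pM // ej => /esym.
  + have [_ e1] := M_sym _ _ (M_mem i li ni); have [_] := M_sym _ _ (M_mem j lj nj).
    by rewrite -em e1.
- move=> j lj; rewrite !cE // => /(cls_eqk lj) e.
  have [eij|nij] := eqVneq i j; first by rewrite -eij -[LHS]/(cls (m i)) e -eij cls_k ?lt_vs.
  have ne : m i != k i.
    by rewrite e; apply: contraNneq nij => /k_inj ->; rewrite ?lt_vs.
  have [_] := M_sym _ _ (M_mem i li ne).
  by rewrite e pM // => ->; rewrite cls_k ?lt_vs.
rewrite cE // => /(clsm i li) ei.
have kN : k i \notin cover M.
  apply/negP => /(in_cover_partner mM)/(subsetP sM); rewrite pM // ei.
  by have := adjxx sE (k i); rewrite /adj => ->.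
split.
  apply/eqP; rewrite cards_eq0; apply/eqP/setP => x; rewrite !inE.
  apply/negP => /andP [xvs /eqP nx].
  have ax : adj E (k i) x by rewrite adj_nb // nx.
  have := cM _ _ ax; rewrite (negbTE kN) /= => /coverk [j lj [nj [xk|xm]]].
    by move: xvs; rewrite xk mem_nth ?lt_vs.
  have := m_leaf j lj; rewrite -xm /cls (negbTE xvs) nx => /(_ isT) eij.
  have {}eij : i = j by lia.
  by move: nj; rewrite -eij ei eqxx.
move=> y ly.
have cy : cls (k y) = y by apply: cls_k.
rewrite -{1}cy core_adj_cls // => ay.
have := cM _ _ ay; rewrite (negbTE kN) /= => /coverk [j lj [nj yj]].
have njc : cls (m j) != j by apply: contra nj => /eqP/(clsm j lj) ->.
apply/hasP; exists j; first by rewrite mem_iota.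
rewrite cE // njc /=; case: yj => [yk|ym].
  by rewrite (k_inj ly (lt_vs lj) yk) eqxx.
by rewrite -ym cy eqxx orbT.
Qed.

Lemma config_maximal p : config rows pres (map cls (quad p)) ->
  [/\ maximal_matching E (quad_matching p), partners (quad_matching p) = p &
      #|quad_matching p| = config_size (map cls (quad p))].
Proof.
set M := quad_matching p; set m := nth x0 (quad p) => /configP cs.
have cE i : i < 4 -> nth 0 (map cls (quad p)) i = cls (m i).
  by move=> li; rewrite (nth_map x0).
have m_opt i : i < 4 -> m i != k i -> adj E (k i) (m i).
  move=> li ne; have [+ _ _ _] := cs i li; rewrite /opt cE // core_adj_cls //.
  by case/orP => // /eqP /(cls_eqk li) e; rewrite e eqxx in ne.
have m_inj i j : i < 4 -> j < 4 -> m i = m j -> i = j.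
  move=> li lj e; have [_ + _ _] := cs i li => /(_ j lj); rewrite !cE // e eqxx.
  by have [->|_ /(_ isT)] := eqVneq j i.
have m_sym i j : i < 4 -> j < 4 -> m i = k j -> m j = k i.
  move=> li lj e; have [_ _ + _] := cs i li => /(_ j lj); rewrite !cE // e.
  by rewrite cls_k ?lt_vs // => /(_ erefl)/(cls_eqk li).
(* If the partner has a smaller code it is a core vertex, and by symmetry the edge is recorded
   there. *)
have M_mem i : i < 4 -> m i != k i -> [set k i; m i] \in M.
  move=> li ne; have [lc|] := ltnP i (cls (m i)).
    by apply/imsetP; exists (Ordinal li); rewrite ?inE.
  rewrite leq_eqVlt => /orP [/eqP /(cls_eqk li) e|lc]; first by rewrite e eqxx in ne.
  have lj : cls (m i) < 4 by lia.
  have e : m i = k (cls (m i)) by apply: cls_eqk.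
  have ej := m_sym _ _ li lj e.
  apply/imsetP; exists (Ordinal lj); rewrite ?inE /= -/m ej ?cls_k ?lt_vs //.
  by rewrite -e setUC.
have M_inv e : e \in M -> exists2 i, i < 4 & m i != k i /\ e = [set k i; m i].
  case/imsetP => i; rewrite inE -/m => lc ->; exists (nat_of_ord i) => //; split=> //.
  by apply: contraL lc => /eqP ->; rewrite cls_k ?lt_vs // ltnn.
have k_inj4 i j : i < 4 -> j < 4 -> k i = k j -> i = j.
  by move=> li lj; apply: k_inj; apply: lt_vs.
have m_M i : i < 4 -> m i = k i -> forall y, [set k i; y] \notin M.
  move=> li ei y; apply/negP => /M_inv [j lj [nj e]].
  have : k i \in [set k j; m j] by rewrite -e !inE eqxx.
  rewrite !inE => /orP [] /eqP e'.
    by move: nj; rewrite -(k_inj4 i j) // ei eqxx.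
  have := m_sym _ _ lj li (esym e'); rewrite ei => /k_inj4 eij.
  by move: nj; rewrite -eij // ei eqxx.
have mM : matching E M.
  apply/matchingP => //; split.
    by apply/subsetP => e /M_inv [i li [ni ->]]; apply: m_opt.
  move=> e1 e2 x /M_inv [i li [ni ->]] /M_inv [j lj [nj ->]].
  have sw a b : a < 4 -> b < 4 -> k a = m b -> [set k a; m a] = [set k b; m b].
    by move=> la lb e; rewrite -e (m_sym b a) // setUC.
  rewrite !inE => /orP [] /eqP -> /orP [] /eqP e.
  - by rewrite (k_inj4 i j).
  - exact: sw.
  - by apply/esym/sw.
  - by rewrite (m_inj i j).
have coverM i : i < 4 -> m i != k i -> (k i \in cover M) && (m i \in cover M).
  by move=> li ni; apply/andP; split; apply/bigcupP; exists [set k i; m i];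
    rewrite ?M_mem // !inE eqxx ?orbT.
split.
- apply/maximal_matchingP => //; split=> //.
  (* An unmatched core vertex has no leaves, so such a [y] is a numbered vertex, and [class_sat]
     says it is covered. *)
  have half i y : i < 4 -> adj E (k i) y -> (k i \in cover M) || (y \in cover M).
    move=> li ay; have [ei|ni] := eqVneq (m i) (k i); last first.
      by have /andP [->] := coverM i li ni.
    have [_ _ _] := cs i li; rewrite cE // ei cls_k ?lt_vs // => /(_ erefl) [l0 sat].
    have [yvs|yvs] := boolP (y \in vs); last first.
      move/eqP: l0; rewrite cards_eq0 => /eqP/setP/(_ y); rewrite !inE yvs /=.
      by move: ay; rewrite adj_nb // eq_sym => ->.
    have := sat (cls y); rewrite cls_lt_size // core_adj_cls // ay => /(_ isT isT).
    case/hasP => j; rewrite mem_iota => lj; rewrite cE // => /andP [nj yj].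
    have {}nj : m j != k j.
      by apply: contra nj => /eqP ->; rewrite cls_k ?lt_vs.
    have /andP [c1 c2] := coverM j lj nj.
    case/orP: yj => /eqP e.
      by rewrite (cls_eqk lj e) c1 orbT.
    by rewrite (@cls_inj y (m j)) ?cls_lt7 // c2 orbT.
  move=> x y xy; have := vs_cover xy; rewrite -!cls_lt4 => /orP [] lc.
    by rewrite -(k_cls (x := x)) ?half ?k_cls //; lia.
  by rewrite orbC -(k_cls (x := y)) ?half ?k_cls 1?adjC //; lia.
- apply/partners_eqP => i li.
  have [ei|ni] := eqVneq (m i) (k i); last by apply: (partnerE sE mM); apply: M_mem.
  case: (partner_adj M (k i)) => [->|h]; first by rewrite -ei.
  by move/negP: (m_M i li ei (partner M (k i))).
rewrite card_in_imset.
  rewrite /config_size -sum1_card -sum1_count big_mkcond [RHS]big_mkcond.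
  rewrite -[iota 0 4]/(index_iota 0 4) big_mkord.
  by apply: eq_bigr => i _; rewrite inE cE.
(* Were one edge recorded from both ends, each end would have a smaller code than the other. *)
move=> i j; rewrite !inE -/m => lci lcj e; apply: val_inj => /=.
have : k i \in [set k j; m j] by rewrite -e !inE eqxx.
rewrite !inE => /orP [] /eqP e'; first exact: k_inj4.
have := m_sym _ _ (ltn_ord j) (ltn_ord i) (esym e').
move: lci lcj => + + h; rewrite h -e' !cls_k ?lt_vs //; lia.
Qed.

Lemma core_edgeP e : e \in E ->
  exists i y, [/\ i < 4, i < cls y, adj E (k i) y & e = [set k i; y]].
Proof.
move=> eE; have [x [y [xy ee]]] := edgeP sE eE.
wlog lxy : x y xy ee / cls x < cls y => [th|].
  have [||exy] := ltngtP (cls x) (cls y); first exact: th.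
    by apply: th; rewrite 1?adjC // ee setUC.
  have := vs_cover xy; rewrite -!cls_lt4 -exy orbb => lc.
  have := edge_neq sE xy; rewrite (@cls_inj x y) ?eqxx //; lia.
have lx : cls x < 4 by have := vs_cover xy; rewrite -!cls_lt4; lia.
have kx : k (cls x) = x by apply: k_cls; lia.
by exists (cls x), y; rewrite kx.
Qed.

Lemma quad_partners M : maximal_matching E M -> quad_matching (partners M) = M.
Proof.
move=> maxM; have [mM _] := (maximal_matchingP sE M).1 maxM.
have [sM dM] := (matchingP E M).1 mM.
apply/setP => e; apply/imsetP/idP.
  case=> i; rewrite inE nth_partners // => lc ->.
  case: (partner_adj M (k i)) => // h.
  by move: lc; rewrite h cls_k ?lt_vs // ltnn.
move=> eM; have [i [y [li ly _ ee]]] := core_edgeP (subsetP sM _ eM).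
have px : partner M (k i) = y by apply: (partnerE sE mM); rewrite -ee.
by exists (Ordinal li); rewrite ?inE nth_partners //= px.
Qed.

(** If an earlier core vertex chose the current one, symmetry dictates the answer. Otherwise an
    earlier core vertex as partner would violate symmetry, and a repeated code injectivity. *)
Lemma config_fits t c t' : size t + size t' = 3 ->
  config rows pres (t ++ c :: t') -> fits rows t c.
Proof.
move=> st /configP cs; set s := t ++ c :: t' in cs.
have sc : nth 0 s (size t) = c by rewrite nth_cat ltnn subnn.
have sj j : j < size t -> nth 0 s j = nth 0 t j by move=> lj; rewrite nth_cat lj.
have lt : size t < 4 by lia.
have [oi di si ui] := cs _ lt; rewrite /fits; move: oi; rewrite sc => ->.
case: ifP => [it|/negbT nit].
  have lj : index (size t) t < size t by rewrite index_mem.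
  have [_ _ h _] := cs (index (size t) t) (ltn_trans lj lt).
  by rewrite -sc h // sj // nth_index.
apply/andP; split.
  rewrite leqNgt; apply/negP => lc.
  have := si c (ltn_trans lc lt); rewrite sc sj // => /(_ erefl) e.
  by move/negP: nit; apply; rewrite -[X in X \in _]e mem_nth.
apply/negP => ct; have lj : index c t < size t by rewrite index_mem.
have := di (index c t) (ltn_trans lj lt); rewrite sc sj // nth_index // eqxx.
by move=> /(_ _)/negP; apply=> //; rewrite neq_ltn lj.
Qed.

Lemma sum_maximal (phi : nat -> nat) :
  \sum_(M in maximal_matchings E) phi #|M| =
  peval (matching_poly rows pres phi) layout_leaves.
Proof.
rewrite /matching_poly; set f := config_weight rows pres phi.
transitivity (class_sum f 4 [::]); last first.
  rewrite class_sum_peval ?drop0 // => t c t' st nf; rewrite /f /config_weight.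
  by case: ifP => // /(config_fits st); rewrite (negbTE nf).
(* Maximal matchings correspond to their partner quadruples; every other quadruple has weight
   zero. *)
rewrite /= (reindex_onto quad_matching partners) /=; last first.
  by move=> M; rewrite inE => /quad_partners.
transitivity (\sum_p f (map cls (quad p))).
  rewrite big_mkcond; apply: eq_bigr => p _; rewrite inE /f /config_weight.
  case: ifP => [/andP [h1 /eqP h2]|h].
    have c := maximal_config h1 h2; rewrite c.
    by have [_ _ ->] := config_maximal c.
  by case: ifP => // /config_maximal [h1 h2 _]; rewrite h1 h2 eqxx in h.
by rewrite !pair_bigA.
Qed.

(** * Edge count and closed sets of a layout *)

Lemma card_edges : #|E| = edge_count rows + sumn layout_leaves.
Proof.
(* Each edge is represented once, by its end of smaller code, which lies in the core. *)
pose P := [set q : 'I_4 * T | (q.1 < cls q.2) && adj E (k q.1) q.2].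
have -> : E = [set [set k q.1; q.2] | q : 'I_4 * T in P].
  apply/setP => e; apply/idP/imsetP; last first.
    by case=> q; rewrite inE => /andP [_ h] ->.
  move=> /core_edgeP [i [y [li ly iy ee]]].
  by exists (Ordinal li, y); rewrite ?inE /= ?ly.
rewrite card_in_imset; last first.
  move=> [i x] [j y]; rewrite !inE /= => /andP [li _] /andP [lj _] e.
  have : k i \in [set k j; y] by rewrite -e !inE eqxx.
  have : k j \in [set k i; x] by rewrite e !inE eqxx.
  have kij : k i = k j -> (i, x) = (j, y).
    move=> kk; have ij : i = j.
      exact/val_inj/(k_inj (lt_vs (ltn_ord i)) (lt_vs (ltn_ord j)) kk).
    subst j; congr (_, _).
    have : x \in [set k i; y] by rewrite -e !inE eqxx orbT.
    rewrite !inE => /orP [] /eqP // ex.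
    by move: li; rewrite ex cls_k ?lt_vs // ltnn.
  rewrite !inE => /orP [/eqP e1 _|/eqP e1]; first exact/kij/esym.
  case/orP => [/eqP/kij //|/eqP e2].
  by move: li lj; rewrite -e1 -e2 !cls_k ?lt_vs //; lia.
rewrite -sum1_card big_mkcond; under eq_bigr do rewrite inE.
rewrite -(pair_bigA _ (fun (i : 'I_4) x => if (i < cls x) && adj E (k i) x then 1 else 0)).
rewrite exchange_big.
pose G c := count (fun i => (i < c) && core_adj rows i c) (iota 0 4).
transitivity (\sum_x G (cls x)).
  apply: eq_bigr => x _; rewrite /G -sum1_count [RHS]big_mkcond.
  rewrite -[iota 0 4]/(index_iota 0 4) big_mkord.
  by apply: eq_bigr => i _; rewrite core_adj_cls.
rewrite sum_cls; congr (_ + _).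
  by rewrite /edge_count sumnE big_map size_rows.
rewrite sumnE big_map -[iota 0 4]/(index_iota 0 4) big_mkord.
by apply: eq_bigr => -[[|[|[|[|i]]]] li] _; rewrite ?muln1.
Qed.

(** A leaf has a single neighbour, so it cannot belong to a set of minimum degree two. *)
Lemma closed2_vs c : closed2 E c -> {subset c <= vs}.
Proof.
move=> cc x xc; apply/negPn/negP => nx; have [y [z [_ _ yz xy xz]]] := cc x xc.
have nbr w : adj E x w -> w = k (nb x).
  move=> xw; have := vs_cover xw.
  rewrite [index x vs]memNindex // ltnNge vs_ge4 /= => lw.
  have wk : k (index w vs) = w by rewrite nth_index // -index_mem (leq_trans lw).
  have := adj_nb nx lw; rewrite wk adjC xw => /esym/eqP <-.
  by rewrite wk.
by rewrite (nbr _ xy) (nbr _ xz) eqxx in yz.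
Qed.

Definition trace (c : seq T) := [seq x \in c | x <- vs].

Lemma nth_trace c i : i < size vs -> nth false (trace c) i = (k i \in c).
Proof. by move=> li; rewrite (nth_map x0). Qed.

Lemma min_degree2_trace c : closed2 E c -> min_degree2 (rows) (trace c).
Proof.
move=> cc; apply/allP => i; rewrite mem_iota size_rows => li.
apply/implyP; rewrite nth_trace // => /cc [y [z [yc zc yz xy xz]]].
have sub w : w \in c -> adj E (k i) w -> cls w \in
    [seq c' <- iota 0 (size vs) | nth false (trace c) c' && class_adj (rows) i c'].
  move=> wc iw; have wvs := closed2_vs cc wc.
  rewrite mem_filter mem_iota /= cls_lt_size // andbT nth_trace ?cls_lt_size //.
  rewrite k_cls ?cls_lt7 // wc /= -{1}[i](cls_k li).
  by rewrite class_adj_cls ?mem_nth.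
have yvs := closed2_vs cc yc; have zvs := closed2_vs cc zc.
rewrite -size_filter -[2]/(size [:: cls y; cls z]).
apply: uniq_leq_size.
  rewrite /= inE andbT; apply: contra yz => /eqP e.
  by apply/eqP; apply: (cls_inj _ e); rewrite ?cls_lt7.
by move=> w; rewrite !inE => /orP [] /eqP ->; apply: sub.
Qed.

Lemma two_cycle_layout c1 c2 u : closed2 E c1 -> closed2 E c2 ->
  (forall x, (x \in c1) && (x \in c2) = (x == u)) ->
  two_cycle_pattern (rows).
Proof.
move=> cc1 cc2 c12.
have inb c : trace c \in words bools (size (rows)).
  have -> : size (rows) = size (trace c) by rewrite !size_map.
  by apply: mem_words => -[].
apply/hasP; exists (trace c1); first by rewrite mem_filter min_degree2_trace ?inb.
apply/hasP; exists (trace c2); first by rewrite mem_filter min_degree2_trace ?inb.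
have /andP [u1 _] : (u \in c1) && (u \in c2) by rewrite c12.
rewrite /meet1 size_rows.
have -> : count (fun i => nth false (trace c1) i && nth false (trace c2) i) (iota 0 (size vs)) =
    count_mem u vs.
  rewrite -[in RHS](mkseq_nth x0 vs) count_map; apply: eq_in_count => i.
  by rewrite mem_iota => li; rewrite !nth_trace //= c12.
by rewrite count_uniq_mem // (closed2_vs cc1 u1).
Qed.

End Layout.

(** * The graph R_n(3,3) *)

Section Average.
Variables (T : finType) (E : {set {set T}}).

Definition total_size := \sum_(M in maximal_matchings E) #|M|.

Lemma avmE : avm E = (total_size%:R / #|maximal_matchings E|%:R)%R.
Proof. by rewrite /avm /total_size natr_sum. Qed.

Lemma maximal_matchings_gt0 : 0 < #|maximal_matchings E|.
Proof.
have m0 : matching E set0.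
  by apply/matchingP; split=> [|e1 e2 x]; rewrite ?sub0set ?inE.
have [M maxM _] := maxset_exists m0.
apply/card_gt0P; exists M; rewrite inE /maximal_matching.
have [mM h] := maxsetP maxM; rewrite mM /=.
by apply/forallP => M'; apply/implyP => /andP [mM' sM]; apply/eqP/h.
Qed.

End Average.

Lemma avm_lt (T T' : finType) (E : {set {set T}}) (E' : {set {set T'}}) :
  total_size E * #|maximal_matchings E'| < total_size E' * #|maximal_matchings E| ->
  (avm E < avm E')%R.
Proof.
move=> lt; rewrite !avmE ltr_pdivrMr ?ltr0n ?maximal_matchings_gt0 //.
rewrite mulrAC ltr_pdivlMr ?ltr0n ?maximal_matchings_gt0 //.
by rewrite -!natrM ltr_nat.
Qed.

(** Composing with the transposition of [f x] and [y] corrects the head without disturbing the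
    images of the tail, which differ from both. *)
Lemma perm_extend (T : finType) (s t : seq T) : uniq s -> uniq t -> size s = size t ->
  exists f : {perm T}, map f s = t.
Proof.
elim: s t => [|x s IH] [|y t] //=; first by exists 1%g.
move=> /andP [xs us] /andP [yt ut] [/(IH t us ut) [f fs]].
exists (f * tperm (f x) y)%g; rewrite permM tpermL; congr (_ :: _).
rewrite -[RHS]fs; apply/eq_in_map => z zs; rewrite permM tpermD //.
  by apply: contraNneq xs => /perm_inj ->.
by apply: contraNneq yt => ->; rewrite -fs map_f.
Qed.

Section R33.
Variable m : nat.
Hypothesis m_ge5 : 5 <= m.
Notation n := m.+1.
Notation R := (R33 n).

Lemma R_edge_lt i j : R_edge i j -> i < j.
Proof.
rewrite /R_edge => /orP [|/andP [/eqP ->]]; last by lia.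
by rewrite !inE => /or4P [/eqP [-> ->]|/eqP [-> ->]|/eqP [-> ->]|
  /or3P [/eqP [-> ->]|/eqP [-> ->]|/eqP [-> ->]]].
Qed.

Lemma R_edge_lt4 i j : R_edge i j -> i < 4.
Proof.
rewrite /R_edge => /orP [|/andP [/eqP -> //]].
by rewrite !inE => /or4P [/eqP [-> _]|/eqP [-> _]|/eqP [-> _]|
  /or3P [/eqP [-> _]|/eqP [-> _]|/eqP [-> _]]].
Qed.

Lemma R33P e : e \in R -> exists x y : 'I_n, [/\ e = [set x; y], x < y & R_edge x y].
Proof.
rewrite inE => /existsP [x /existsP [y /and3P [/eqP -> lt xy]]].
by exists x, y.
Qed.

Lemma simple_R33 : simple_graph R.
Proof.
move=> e /R33P [x [y [-> lt _]]]; rewrite cards2.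
by have -> : x != y by apply: contraTneq lt => ->; rewrite ltnn.
Qed.

Lemma adj_R33 (x y : 'I_n) : adj R x y = R_edge x y || R_edge y x.
Proof.
apply/idP/idP.
  case/R33P => x' [y' [e lt xy]].
  have xe : x \in [set x'; y'] by rewrite -e !inE eqxx.
  have ye : y \in [set x'; y'] by rewrite -e !inE eqxx orbT.
  have x'e : x' \in [set x; y] by rewrite e !inE eqxx.
  have y'e : y' \in [set x; y] by rewrite e !inE eqxx orbT.
  move: xe ye x'e y'e; rewrite !inE.
  case/orP => /eqP ex; case/orP => /eqP ey; subst x y; rewrite ?xy ?orbT //.
    by rewrite !orbb => _ /eqP e'; move: lt; rewrite e' ltnn.
  by rewrite !orbb => /eqP e'; move: lt; rewrite e' ltnn.
have sub (a b : 'I_n) : R_edge a b -> [set a; b] \in R.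
  move=> ab; rewrite inE; apply/existsP; exists a; apply/existsP; exists b.
  by rewrite eqxx ab R_edge_lt.
by case/orP => /sub //; rewrite /adj setUC.
Qed.

(** The core is v1, v2, u, w1, covered by the maximal matching of v1v2 and uw1. The fifth entry w2
    is adjacent to u and w1, and all leaves hang on core vertex 0, which is v1. *)
Definition R33_vs : seq 'I_n := map inord [:: 1; 2; 0; 3; 4].

Lemma nth_R33_vs i : i < 5 -> nth ord0 R33_vs i = nth 0 [:: 1; 2; 0; 3; 4] i :> nat.
Proof.
move=> li; rewrite (nth_map 0) // inordK //.
by case: i li => [|[|[|[|[|]]]]] //=; lia.
Qed.

Lemma R33_vsE (x : 'I_n) : (x \in R33_vs) = (x < 5).
Proof.
by rewrite !inE -!val_eqE /= !inordK; lia.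
Qed.

Lemma R33_vs_uniq : uniq R33_vs.
Proof.
rewrite map_inj_in_uniq // => i j.
rewrite !inE => hi hj /(f_equal val) /=; rewrite !inordK //; lia.
Qed.

Lemma R33_adj_nb (x : 'I_n) i : x \notin R33_vs -> i < 4 ->
  adj R (nth ord0 R33_vs i) x = (i == 0).
Proof.
rewrite R33_vsE => nx li; rewrite adj_R33 nth_R33_vs; last by lia.
by case: x nx => -[|[|[|[|[|x]]]]] lx //= _; case: i li => [|[|[|[|]]]].
Qed.

Lemma R33_index (x : 'I_n) : x < 4 -> index x R33_vs < 4.
Proof.
rewrite /= -!val_eqE /= !inordK; try lia.
by case: x => -[|[|[|[|x]]]].
Qed.

Lemma R33_cover x y : adj R x y -> (index x R33_vs < 4) || (index y R33_vs < 4).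
Proof.
by rewrite adj_R33 => /orP [] /R_edge_lt4 /R33_index ->; rewrite ?orbT.
Qed.

Lemma R33_rows : layout_rows R ord0 R33_vs =
  [:: [:: false; true; true; false]; [:: true; false; true; false];
      [:: true; true; false; true]; [:: false; false; true; false];
      [:: false; false; true; true]].
Proof. by rewrite /layout_rows /= !adj_R33 !inordK //; lia. Qed.

Lemma R33_leaves : layout_leaves R33_vs (fun _ => 0) = [:: n - 5; 0; 0; 0].
Proof.
have l0 i : i != 0 -> leaves R33_vs (fun _ => 0) i = 0.
  move=> i0; apply/eqP; rewrite cards_eq0; apply/eqP/setP => x.
  by rewrite !inE [0 == i]eq_sym (negbTE i0) andbF.
have := card_layout ord0 R33_vs_uniq (nb := fun _ => 0) (fun _ _ => isT).
by rewrite card_ord /layout_leaves /= (l0 1) // (l0 2) // (l0 3) // => e; congr (_ :: _); lia.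
Qed.

Lemma sum_R33 phi : \sum_(M in maximal_matchings R) phi #|M| =
  peval (matching_poly [:: [:: false; true; true; false]; [:: true; false; true; false];
      [:: true; true; false; true]; [:: false; false; true; false];
      [:: false; false; true; true]] [:: true; false; false; false] phi) [:: n - 5; 0; 0; 0].
Proof.
rewrite (sum_maximal simple_R33 (x0 := ord0) R33_vs_uniq _ _ _ R33_adj_nb R33_cover) //.
rewrite R33_rows /layout_pres R33_leaves /=.
by have -> : 0 < n - 5 by lia.
Qed.

Lemma card_maximal_R33 : #|maximal_matchings R| = 3 * (n - 5) + 4.
Proof.
rewrite -sum1_card (sum_R33 (fun _ => 1)).
set p := matching_poly _ _ _; vm_compute in p; rewrite /p /=; lia.
Qed.

Lemma total_size_R33 : total_size R = 7 * (n - 5) + 8.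
Proof.
rewrite /total_size (sum_R33 id).
set p := matching_poly _ _ _; vm_compute in p; rewrite /p /=; lia.
Qed.

Lemma card_R33 : #|R| = n.+1.
Proof.
rewrite (card_edges simple_R33 (x0 := ord0) R33_vs_uniq _ _ _ R33_adj_nb R33_cover) //.
rewrite R33_rows R33_leaves; set c := edge_count _; have -> : c = 6 by [].
by rewrite /=; lia.
Qed.

(** The permutation sending u, v1, v2, w1, w2 to 0, ..., 4 pulls every edge of [R] back to an edge
    of [E]; equal edge numbers leave room for no others. *)
Lemma R33_iso (E : {set {set 'I_n}}) u v1 v2 w1 w2 :
  #|E| = n.+1 -> uniq [:: u; v1; v2; w1; w2] ->
  [&& adj E u v1, adj E u v2, adj E v1 v2, adj E u w1, adj E u w2 & adj E w1 w2] ->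
  (forall x, x \notin [:: u; v1; v2; w1; w2] -> adj E v1 x) -> isomorphic E R.
Proof.
move=> cE us /and5P [uv1 uv2 v12 uw1 /andP [uw2 w12]] av1.
have ut : uniq (map inord [:: 0; 1; 2; 3; 4] : seq 'I_n).
  rewrite map_inj_in_uniq // => i j.
  rewrite !inE => hi hj /(f_equal val) /=; rewrite !inordK //; lia.
have [f fs] := perm_extend us ut erefl.
exists f => e.
have sub (x y : 'I_n) : R_edge (f x) (f y) -> adj E x y.
  have vf a b i : f b = inord i -> i < 6 -> nat_of_ord (f a) = i -> a = b.
    move=> fb li e1; apply/(perm_inj (s := f))/val_inj; rewrite fb /= inordK //; lia.
  (* An edge of [R] with larger end at least 5 is pendant at 1, the image of [v1]. *)
  move=> xy; have [ge5|lt5] := leqP 5 (f y).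
    have -> : x = v1.
      case: fs => _ f1 _ _ _; apply: (vf _ _ _ f1) => //; move: xy ge5; rewrite /R_edge.
      case/orP => [|/andP [/eqP]] //; rewrite !inE.
      by move=> /or4P [||| /or3P []] /eqP [_ ->].
    apply: av1; apply/negP => /(map_f f); rewrite fs => /mapP [i hi e1].
    by move: hi ge5; rewrite e1 !inE => hi; rewrite inordK; lia.
  case: fs => f0 f1 f2 f3 f4; move: xy lt5; rewrite /R_edge => /orP [|]; last by lia.
  rewrite !inE => /or4P [/eqP [ex ey]|/eqP [ex ey]|/eqP [ex ey]|
    /or3P [/eqP [ex ey]|/eqP [ex ey]|/eqP [ex ey]]] _.
  - by rewrite (vf _ _ _ f0 _ ex) // (vf _ _ _ f1 _ ey).
  - by rewrite (vf _ _ _ f0 _ ex) // (vf _ _ _ f2 _ ey).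
  - by rewrite (vf _ _ _ f1 _ ex) // (vf _ _ _ f2 _ ey).
  - by rewrite (vf _ _ _ f0 _ ex) // (vf _ _ _ f3 _ ey).
  - by rewrite (vf _ _ _ f0 _ ex) // (vf _ _ _ f4 _ ey).
  - by rewrite (vf _ _ _ f3 _ ex) // (vf _ _ _ f4 _ ey).
have RE : R = [set f @: e' | e' : {set 'I_n} in E].
  apply/eqP; rewrite eqEcard card_R33 card_imset ?cE ?leqnn ?andbT; last first.
    exact/imset_inj/perm_inj.
  apply/subsetP => e' /R33P [x [y [-> _ xy]]].
  apply/imsetP; exists [set (f^-1)%g x; (f^-1)%g y].
    by apply: sub; rewrite !permKV.
  by rewrite imsetU !imset_set1 !permKV.
by rewrite RE mem_imset //; apply/imset_inj/perm_inj.
Qed.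

End R33.

(** * The core of a graph with a maximal matching of size two *)

Section Core.
Variables (T : finType) (E : {set {set T}}).
Hypothesis sE : simple_graph E.
Hypothesis E_nbr : forall x, exists y, adj E x y.
Hypothesis card_E : #|E| = #|T|.+1.
Variables a b c d : T.
Notation ks := [:: a; b; c; d].
Hypothesis ks_uniq : uniq ks.
Hypothesis ab : adj E a b.
Hypothesis cd : adj E c d.
Hypothesis ks_cover : forall x y, adj E x y -> (x \in ks) || (y \in ks).

Definition core_degree x := count (fun y => adj E y x) ks.
Definition inner := [seq x <- enum T | (x \notin ks) && (2 <= core_degree x)].
Definition core_vs := ks ++ inner.
(** Used only outside [core_vs], where [x] has exactly one core neighbour. *)
Definition core_nb x := find (fun y => adj E y x) ks.

Lemma mem_inner x : (x \in inner) = (x \notin ks) && (2 <= core_degree x).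
Proof. by rewrite mem_filter mem_enum andbT. Qed.

Lemma core_vs_uniq : uniq core_vs.
Proof.
rewrite cat_uniq ks_uniq filter_uniq ?enum_uniq // andbT /=.
by apply/hasPn => x; rewrite mem_inner => /andP [].
Qed.

Lemma core_degree_gt0 x : x \notin ks -> 0 < core_degree x.
Proof.
move=> nx; have [y xy] := E_nbr x; have := ks_cover xy; rewrite (negbTE nx) /= => yk.
by rewrite -has_count; apply/hasP; exists y; rewrite // adjC.
Qed.

(* Two core edges, one edge per outer vertex and a second one per inner vertex
   already make [#|T| - 2 + size inner] edges. *)
Lemma size_inner : size inner <= 3.
Proof.
pose P := [set q : T * T | [&& q.1 \in ks, q.2 \notin ks & adj E q.1 q.2]].
have inP : {in P &, injective (fun q : T * T => [set q.1; q.2])}.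
  move=> [x y] [x' y']; rewrite !inE /= => /and3P [xk yk _] /and3P [xk' yk' _] e.
  have : x \in [set x'; y'] by rewrite -e !inE eqxx.
  have : y \in [set x'; y'] by rewrite -e !inE eqxx orbT.
  rewrite !inE => /orP [] /eqP ey /orP [] /eqP ex; subst x y => //.
  - by rewrite xk' in yk.
  - by rewrite xk' in yk.
  - by rewrite xk in yk'.
have eab : [set a; b] != [set c; d].
  apply/eqP => e; have : a \in [set c; d] by rewrite -e !inE eqxx.
  by move: ks_uniq; rewrite /= !inE => h; lia.
have sub : [set a; b] |: ([set c; d] |: [set [set q.1; q.2] | q : T * T in P]) \subset E.
  rewrite !subUset !sub1set -/(adj E a b) -/(adj E c d) ab cd /=.
  by apply/subsetP => e /imsetP [q]; rewrite inE => /and3P [_ _ h] ->.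
have nP x y : x \in ks -> y \in ks -> [set x; y] \notin [set [set q.1; q.2] | q : T * T in P].
  move=> xk yk; apply/negP => /imsetP [q]; rewrite inE => /and3P [_ h _] e.
  have : q.2 \in [set x; y] by rewrite e !inE eqxx orbT.
  by rewrite !inE => /orP [] /eqP e'; move: h; rewrite e' ?xk ?yk.
have := subset_leq_card sub; rewrite cardsU1 cardsU1 !inE (negbTE eab) /= !nP ?inE ?eqxx ?orbT //.
rewrite card_in_imset // card_E => le.
(* Edges between the core and the rest are counted by their outer end. *)
have cP : #|P| = \sum_(x | x \notin ks) core_degree x.
  rewrite -sum1_card big_mkcond /=; under eq_bigr do rewrite inE.
  rewrite -(pair_bigA _ (fun x y => if [&& x \in ks, y \notin ks & adj E x y] then 1 else 0)).
  rewrite exchange_big [RHS]big_mkcond; apply: eq_bigr => y _.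
  case: ifP => yk; last by apply: big1 => x _; rewrite andbF.
  rewrite /core_degree -sum1_count [RHS]big_mkcond [RHS]big_uniq; last exact: ks_uniq.
  by rewrite [RHS]big_mkcond; apply: eq_bigr => x _; case: (x \in ks).
have : \sum_(x | x \notin ks) (1 + (x \in inner)) <= #|P|.
  rewrite cP; apply: leq_sum => x nx; rewrite mem_inner nx /=.
  have := core_degree_gt0 nx; case: (leqP 2 (core_degree x)); lia.
rewrite big_split /= sum1_card.
have -> : \sum_(x | x \notin ks) (x \in inner : nat) = size inner.
  rewrite -(card_uniqP (filter_uniq _ (enum_uniq T))) -sum1_card.
  rewrite big_mkcond [RHS]big_mkcond; apply: eq_bigr => x _.
  by rewrite mem_inner; case: (x \in ks) => //=; case: (1 < _).
have := cardC (mem ks); rewrite (card_uniqP ks_uniq).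
have -> : #|predC (mem ks)| = #|[pred x | x \notin ks]| by apply: eq_card.
move=> h1 h2; rewrite /= !add1n -h1 in le.
have := leq_trans (h2 : (_ + _).+2 <= _.+2) le; rewrite /=; lia.
Qed.

Lemma core_nb_lt4 x : x \notin core_vs -> core_nb x < 4.
Proof.
rewrite mem_cat negb_or => /andP [nx _].
by have := core_degree_gt0 nx; rewrite -has_count has_find.
Qed.

Lemma core_adj_nb x i : x \notin core_vs -> i < 4 ->
  adj E (nth a core_vs i) x = (i == core_nb x).
Proof.
rewrite mem_cat mem_inner negb_or => /andP [nx]; rewrite nx /= -leqNgt => le1 li.
have := core_degree_gt0 nx; move: le1; rewrite nth_cat li /core_nb /core_degree /=.
by case: i li => [|[|[|[|i]]]] //= _;
  case: (adj E a x); case: (adj E b x); case: (adj E c x); case: (adj E d x).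
Qed.

Lemma core_vs_cover x y : adj E x y -> (index x core_vs < 4) || (index y core_vs < 4).
Proof.
have ix z : z \in ks -> index z core_vs < 4.
  by move=> zk; rewrite index_cat zk -[4]/(size ks) index_mem.
by move/ks_cover => /orP [] /ix ->; rewrite ?orbT.
Qed.

Lemma core_vs_le7 : size core_vs <= 7.
Proof. by rewrite size_cat -[7]/(4 + 3) leq_add2l size_inner. Qed.

Lemma core_layout_rows : layout_rows E a core_vs =
  core_rows (adj E c a) (adj E d a) (adj E c b) (adj E d b) ++
  [seq [seq adj E y x | y <- ks] | x <- inner].
Proof.
rewrite /layout_rows map_cat /= !(adjxx sE) (adjC E b a) (adjC E d c) ab cd.
by rewrite (adjC E a c) (adjC E b c) (adjC E a d) (adjC E b d).
Qed.

Lemma core_check : check_rows (layout_rows E a core_vs).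
Proof.
rewrite core_layout_rows; have := check_allT.
have inb (l : seq bool) : l \in words bools (size l).
  by apply: mem_words => -[].
move=> /allP/(_ [:: adj E c a; adj E d a; adj E c b; adj E d b] (inb _)).
move=> /allP/(_ (size inner)); rewrite mem_iota => /(_ size_inner)/allP; apply.
rewrite -(size_map (fun x => [seq adj E y x | y <- ks])); apply: mem_words.
move=> r /mapP [x]; rewrite mem_inner => /andP [_ d2] ->.
by rewrite mem_filter (inb [:: _; _; _; _]) andbT count_map.
Qed.

End Core.

(** * Comparison of the averages *)

Lemma criterion_eval rows l : size l = 4 -> let pres := [seq 0 < x | x <- l] in
  let N := peval (matching_poly rows pres (fun _ => 1)) l in
  let Z := peval (matching_poly rows pres id) l in
  criterion rows pres ->
  (7 * N <= 3 * Z) && (2 * N + 1 <= Z) ||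
  (7 * N <= 3 * Z + 3) && (2 * N + (size rows + sumn l) <= Z + 5).
Proof.
move=> sl pres; rewrite /criterion.
move: (matching_poly _ _ (fun _ => 1)) (matching_poly _ _ id) => N Z.
case/orP => /andP [h1 h2]; apply/orP; [left|right]; apply/andP; split.
- by have := ple_eval sl h1; rewrite !peval_scale.
- by have := ple_eval sl h2; rewrite peval_add peval_scale peval_const.
- by have := ple_eval sl h1; rewrite peval_add !peval_scale peval_const.
by have := ple_eval sl h2; rewrite !peval_add peval_scale peval_const peval_lin.
Qed.

(** With k = n - 5 > 0, the second alternative gives k (3 Z - 7 N) + 4 (Z - 2 N) >= -3k + 4k = k >
    0. *)
Lemma avm_gt_R33 m (E : {set {set 'I_m.+1}}) : 5 <= m ->
  let N := #|maximal_matchings E| in let Z := total_size E in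
  (7 * N <= 3 * Z) && (2 * N + 1 <= Z) ||
  (7 * N <= 3 * Z + 3) && (2 * N + m.+1 <= Z + 5) ->
  (avm (R33 m.+1) < avm E)%R.
Proof.
move=> m_ge5 N Z h; apply: avm_lt; rewrite card_maximal_R33 // total_size_R33 // -/N -/Z.
have [k ek] : exists k, m.+1 - 5 = k.+1 by exists (m - 5); lia.
rewrite ek; have em : m.+1 = k + 6 by lia.
by case/orP: h; rewrite ?em => /andP [h1 h2]; nia.
Qed.

Lemma connected_nbr n (E : {set {set 'I_n}}) x : 1 < n -> connected_graph E ->
  exists y, adj E x y.
Proof.
move=> n2 cE.
have [y yx] : exists y : 'I_n, y != x.
  have : 0 < #|[set~ x]| by rewrite cardsC1 card_ord; lia.
  by case/card_gt0P => y; rewrite !inE; exists y.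
have /connectP [[|z p] /=] := cE x y; first by move=> _ e; rewrite e eqxx in yx.
by case/andP => xz _ _; exists z.
Qed.

Lemma core_of_matching (T : finType) (E : {set {set T}}) M :
  simple_graph E -> maximal_matching E M -> #|M| = 2 ->
  exists a b c d, [/\ uniq [:: a; b; c; d], adj E a b, adj E c d &
    forall x y, adj E x y -> (x \in [:: a; b; c; d]) || (y \in [:: a; b; c; d])].
Proof.
move=> sE maxM /eqP/cards2P [e1 [e2 [e12 eM]]].
have [mM cM] := (maximal_matchingP sE M).1 maxM; have [sM dM] := (matchingP E M).1 mM.
have e1M : e1 \in M by rewrite eM !inE eqxx.
have e2M : e2 \in M by rewrite eM !inE eqxx orbT.
have [a [b [ab ee1]]] := edgeP sE (subsetP sM _ e1M).
have [c [d [cd ee2]]] := edgeP sE (subsetP sM _ e2M).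
have dis x : x \in e1 -> x \notin e2.
  by move=> x1; apply: contra e12 => x2; apply/eqP/(dM _ _ x).
exists a, b, c, d; split=> //.
  have := dis a; have := dis b; rewrite ee1 ee2 !inE !eqxx orbT => /(_ isT) nb /(_ isT) na.
  by rewrite /= !inE (negbTE (edge_neq sE ab)) (edge_neq sE cd) na nb.
have cov x : x \in cover M -> x \in [:: a; b; c; d].
  case/bigcupP => e; rewrite eM !inE => /orP [] /eqP ->; rewrite ?ee1 ?ee2 !inE.
    by case/orP => ->; rewrite ?orbT.
  by case/orP => ->; rewrite ?orbT.
by move=> x y /cM /orP [] /cov ->; rewrite ?orbT.
Qed.

Lemma sumn_eq0 l : ~~ has id [seq 0 < x | x <- l] -> sumn l = 0.
Proof. by elim: l => //= x l IH; rewrite negb_or -leqNgt leqn0 => /andP [/eqP -> /IH ->]. Qed.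

Lemma avm_core m (E : {set {set 'I_m.+1}}) a b c d c1 c2 u : 5 <= m ->
  simple_graph E -> connected_graph E -> #|E| = m.+2 ->
  uniq [:: a; b; c; d] -> adj E a b -> adj E c d ->
  (forall x y, adj E x y -> (x \in [:: a; b; c; d]) || (y \in [:: a; b; c; d])) ->
  closed2 E c1 -> closed2 E c2 ->
  (forall x, (x \in c1) && (x \in c2) = (x == u)) ->
  (avm (R33 m.+1) < avm E)%R \/ isomorphic E (R33 m.+1).
Proof.
move=> m5 sE cE cardE ks_uniq ab cd ks_cover cc1 cc2 c12.
have E_nbr x : exists y, adj E x y by apply: connected_nbr => //; lia.
have cardE' : #|E| = #|'I_m.+1|.+1 by rewrite card_ord.
have vs_u := core_vs_uniq E ks_uniq.
have vs_7 : size (core_vs E a b c d) <= 7 by apply: core_vs_le7.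
have nb4 := core_nb_lt4 E_nbr ks_cover.
have anb := core_adj_nb E_nbr ks_cover.
have vsc := core_vs_cover ks_cover.
have := core_check sE E_nbr cardE' ks_uniq ab cd ks_cover.
set vs := core_vs E a b c d in vs_u vs_7 nb4 anb vsc *.
set nb := core_nb E a b c d in nb4 anb.
have vs_4 : 4 <= size vs by [].
set rows := layout_rows E a vs; pose pres := layout_pres vs nb.
have sr : size rows = size vs by apply: size_rows.
have ec := card_edges sE vs_u vs_4 vs_7 nb4 anb vsc.
have cl := card_layout a vs_u nb4; rewrite card_ord in cl.
have ct := two_cycle_layout vs_u vs_4 vs_7 anb vsc cc1 cc2 c12.
have szl : size (layout_leaves vs nb) = 4 by [].
rewrite /check_rows sr.
have -> : edge_count rows == (size vs).+1 by apply/eqP; rewrite -/rows in ec; lia.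
rewrite ct => /allP/(_ pres).
have -> : pres \in words bools 4 by apply: (@mem_words _ bools pres) => -[].
(* Without leaves the numbered vertices are all the vertices, and there are at least six. *)
have -> : (6 <= size vs) || has id pres.
  case: leqP => // lt6; rewrite orFb; apply/negPn/negP => np.
  by have := sumn_eq0 np; lia.
move=> /(_ isT); case: ifP => [crit _|_ r33].
  left; apply: avm_gt_R33 => //; move: crit.
  have sums phi := sum_maximal sE vs_u vs_4 vs_7 nb4 anb vsc phi.
  have NE := sums (fun _ => 1); rewrite sum1_card in NE; have ZE := sums id.
  rewrite -/rows -/pres in NE ZE.
  by move/(criterion_eval szl); rewrite /total_size NE ZE sr -cl.
right; move: r33; rewrite /R33_pattern sr.
have I_lt i : (i \in iota 0 (size vs)) = (i < size vs) by rewrite mem_iota.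
case/hasP => u'; rewrite I_lt => lu /hasP [v1]; rewrite I_lt => lv1.
case: ifP => // _ /hasP [v2]; rewrite I_lt => lv2.
case: ifP => // _ /hasP [w1]; rewrite I_lt => lw1.
case: ifP => // _ /hasP [w2]; rewrite I_lt => lw2.
case/and4P => un; rewrite sr; set k := nth a vs.
have ca i j : i < size vs -> j < size vs -> class_adj rows i j = adj E (k i) (k j).
  move=> li lj; rewrite -(class_adj_cls (x0 := a) vs_u vs_4 vs_7 anb vsc) ?mem_nth //.
  by rewrite !cls_k.
rewrite !ca // => adjs /allP others /allP leafs.
have lt5 i : i \in [:: u'; v1; v2; w1; w2] -> i < size vs.
  by rewrite !inE => /or4P [| | |/orP []] /eqP ->.
apply: (@R33_iso _ m5 E (k u') (k v1) (k v2) (k w1) (k w2)) => //.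
  rewrite -[X in uniq X]/(map k [:: u'; v1; v2; w1; w2]) map_inj_in_uniq //.
  by move=> i j /lt5 li /lt5 lj; apply: (k_inj nb vs_u li lj).
move=> x; rewrite -[X in _ \notin X]/(map k [:: u'; v1; v2; w1; w2]) => nx.
have [xvs|xvs] := boolP (x \in vs).
  have lx : index x vs < size vs by rewrite index_mem.
  have xk : k (index x vs) = x by apply: nth_index.
  have := others (index x vs); rewrite I_lt lx => /(_ isT)/implyP.
  rewrite ca // xk; apply; apply: contra nx => h.
  by rewrite -xk map_f.
have := leafs (nb x); rewrite mem_iota nb4 // nth_pres ?nb4 //.
have -> : 0 < leaves vs nb (nb x).
  by apply/card_gt0P; exists x; rewrite inE xvs eqxx.
by move=> /(_ isT)/eqP <-; rewrite anb ?nb4.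
Qed.

Theorem theorem3p6 (n : nat) (E : {set {set 'I_n}}) :
  6 <= n ->
  simple_graph E ->
  connected_graph E ->
  #|E| = n.+1 ->
  two_cycles_one_common_vertex E ->
  ~ isomorphic E (R33 n) ->
  (avm (R33 n) < avm E)%R.
Proof.
case: n E => [|m] E // m5 sE cE cardE [c1 [c2 [/cycle_closed2 cc1 [/cycle_closed2 cc2 c12]]]] niso.
move/eqP/cards1P: c12 => [u c12].
have {}c12 x : (x \in c1) && (x \in c2) = (x == u).
  by move/setP/(_ x): c12; rewrite !inE.
have [/existsP [M /andP [maxM /eqP M2]]|no2] :=
  boolP [exists M, maximal_matching E M && (#|M| == 2)].
  have [a [b [c [d [ks_u ab cd ks_c]]]]] := core_of_matching sE maxM M2.
  by case: (avm_core m5 sE cE cardE ks_u ab cd ks_c cc1 cc2 c12).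
apply: avm_gt_R33 => //=.
(* Here all maximal matchings have at least three edges; with N > 0 this yields the first
   alternative. *)
have Z3 : 3 * #|maximal_matchings E| <= total_size E.
  rewrite mulnC -sum_nat_const; apply: leq_sum => M; rewrite inE => maxM.
  have := maximal_matching_ge2 sE cc1 cc2 c12 maxM.
  rewrite leq_eqVlt => /orP [/eqP M2|//].
  by move/existsP: no2; case; exists M; rewrite maxM -M2.
have := maximal_matchings_gt0 E; move: Z3; move: #|_| (total_size E) => N Z; lia.
Qed.
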